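(* Consider the nonlinear time-periodic problem $\mathbf u'(t)=\mathbf f(\mathbf u(t),t)$, $t\in[0,T]$, $\mathbf u(0)=\mathbf u(T)$, with fine and coarse propagators $\mathcal F_n,\mathcal G_n$ ($0\le n<N$) and fine periodic reference $\mathbf u^\star=(\mathbf u_0^\star,\ldots,\mathbf u_{N-1}^\star)$. Fix an iteration $k$, let $\mathcal I^k\subset\{0,\ldots,N-1\}$ be the selected temporal mode set, and let $P^k=P_{\mathcal I^k}$ be the Fourier-aware projection, i.e. the orthogonal projection of $\mathbb R^d$ onto the mixed Fourier space $\mathcal V_{\rm mix}^k(\mathcal I^k)$, with complement $Q^k:=I-P^k$. Let $\mathbf U^{k+1}\in(\mathbb R^d)^N$ be given by the Fourier-aware projection-based PP-PC update $$\mathbf U_{n+1}^{k+1}=\mathcal F_n(\mathbf U_n^k)+\mathcal H_{P_{\mathcal I^k},n}(\mathbf U_n^{k+1})-\mathcal H_{P_{\mathcal I^k},n}(\mathbf U_n^k),\qquad n=0,\ldots,N-1,\qquad \mathbf U_N^{k+1}=\mathbf U_0^{k+1}.$$ Suppose that the following three assumptions hold with $P=P^k$. (1) Local nonlinear region: there is a convex set $\mathcal B_k\subset\mathbb R^d$ such that for all $n=0,\ldots,N-1$ and $s\in[0,1]$, $\mathbf U_n^k+s\mathbf e_n^k\in\mathcal B_k$, $P(\mathbf U_n^k+s\mathbf e_n^k)\in\mathcal B_k$, and $\mathbf u_n^\star,\mathbf U_n^{k+1}\in\mathcal B_k$; and each $\mathcal H_{P,n}$ is well defined on $\mathcal B_k$.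 (2) Local nondegeneracy: each $\mathcal H_{P,n}$ is continuously differentiable on an open neighborhood of $\mathcal B_k$, and $1$ is not an eigenvalue of $\widehat M_P:=\mathrm D\mathcal H_{P,N-1}(\mathbf u_{N-1}^\star)\cdots\mathrm D\mathcal H_{P,0}(\mathbf u_0^\star)$; equivalently, the linearized cyclic operator $\widehat{\mathcal C}_P$ is invertible. Set $\widehat\Gamma_k:=\|\widehat{\mathcal C}_P^{-1}\|_{\infty\to\infty}$. (3) Local smoothness: each $\mathcal D_n=\mathcal F_n-\mathcal G_n$ is continuously Fréchet differentiable on an open neighborhood of $\mathcal B_k$, and there are constants $\mu_k,\nu_k,\kappa_k\ge 0$ such that for all $\mathbf x,\mathbf y\in\mathcal B_k$ and $n=0,\ldots,N-1$, $$\|\mathrm D\mathcal D_n(\mathbf x)\|_2\le\mu_k,\qquad \|\mathrm D\mathcal D_n(\mathbf x)-\mathrm D\mathcal D_n(\mathbf y)\|_2\le\nu_k\|\mathbf x-\mathbf y\|_2,$$ $$\|\mathrm D\mathcal H_{P,n}(\mathbf x)-\mathrm D\mathcal H_{P,n}(\mathbf y)\|_2\le\kappa_k\|\mathbf x-\mathbf y\|_2 .$$ Suppose also that, for some $R>0$, the update $\mathbf U^{k+1}$ satisfies $E_\infty^{k+1}\le R$, and that the smallness condition $\tfrac12\widehat\Gamma_k\kappa_kR<1$ holds. If $E_\infty^k=0$, then $E_\infty^{k+1}=0$. If $E_\infty^k>0$, then $$E_\infty^{k+1}\le\rho_{k,\mathrm F}\,E_\infty^k,$$ where $$\rho_{k,\mathrm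 F}:=\frac{\widehat\Gamma_k}{1-\tfrac12\widehat\Gamma_k\kappa_kR}\left[\mu_k\Theta_Q^k+\nu_kU_k^\perp(P_{\mathcal I^k})\Theta_P^k+\frac{\nu_k}{2}\Theta_Q^k\Theta_P^kE_\infty^k\right].$$
   Context: Setting. $T>0$, $N$ is a positive integer, $\Delta T=T/N$, $T_n=n\Delta T$. The function $\mathbf f$ is $T$-periodic in $t$ for all states in a domain containing the states considered, and $\mathbf f$ and its state Jacobian $\mathrm D_{\mathbf u}\mathbf f$ are continuous in $(\mathbf u,t)$. For $0\le n<N$, the fine propagator $\mathcal F_n$ and the coarse propagator $\mathcal G_n$ are maps on the state space $\mathbb R^d$; $\mathcal F_n(\mathbf x)$ (resp. $\mathcal G_n(\mathbf x)$) is an accurate (resp. less accurate but cheaper) approximation at time $T_{n+1}$ of the solution of the evolution problem starting from $\mathbf x$ at time $T_n$. $\mathrm D$ denotes the Jacobian with respect to the state, and $I$ is the identity on $\mathbb R^d$. Histories are elements $\mathbf w=(\mathbf w_0,\ldots,\mathbf w_{N-1})\in(\mathbb R^d)^N$; history indices are taken modulo $N$ (so $\mathbf w_N=\mathbf w_0$). Norms: $\|\mathbf w\|_\infty:=\max_{0\le n<N}\|\mathbf w_n\|_2$, and $\|S\|_{\infty\to\infty}:=\sup_{\mathbf w\ne 0}\|S\mathbf w\|_\infty/\|\mathbf w\|_\infty$ for linear operators $S$ on histories; $\|\cdot\|_2$ on matrices is the spectral norm. Fine--coarse discrepancy: $\mathcal D_n(\mathbf x):=\mathcal F_n(\mathbf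 x)-\mathcal G_n(\mathbf x)$. Discrepancy-form propagator for an orthogonal projection $P$: $\mathcal H_{P,n}(\mathbf x):=\mathcal G_n(\mathbf x)+\mathcal D_n(P\mathbf x)$. Fine periodic reference: $\mathbf u^\star=(\mathbf u_0^\star,\ldots,\mathbf u_{N-1}^\star)\in(\mathbb R^d)^N$ satisfying $\mathbf u_{n+1}^\star=\mathcal F_n(\mathbf u_n^\star)$ for $n=0,\ldots,N-1$, with $\mathbf u_N^\star=\mathbf u_0^\star$; its existence is assumed. Iterates and errors: $\mathbf U^0,\ldots,\mathbf U^k\in(\mathbb R^d)^N$ are the iterates (interface values) of the Fourier-aware update, from the initial interface values $\mathbf U^0$ through iteration $k$. $\mathbf e_n^j:=\mathbf u_n^\star-\mathbf U_n^j$, $\mathbf e^j:=(\mathbf e_0^j,\ldots,\mathbf e_{N-1}^j)$, $E_\infty^j:=\max_{0\le n<N}\|\mathbf e_n^j\|_2$. Linearized cyclic operator: the linear operator $\widehat{\mathcal C}_P$ on $(\mathbb R^d)^N$ given by $(\widehat{\mathcal C}_P\mathbf w)_{n+1}:=\mathbf w_{n+1}-\mathrm D\mathcal H_{P,n}(\mathbf u_n^\star)\mathbf w_n$, $n=0,\ldots,N-1$, indices modulo $N$. Temporal Fourier coefficients of a history $\mathbf w$: $\widehat{\mathbf w}_\ell:=\frac1{\sqrt N}\sum_{n=0}^{N-1}\mathbf w_n\exp(-2\pi\imath\ell n/N)\in\mathbb C^d$, $\ell=0,\ldots,N-1$, where $\imath$ is the imaginary unit. Selected temporal mode set $\mathcal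 I^k\subset\{0,\ldots,N-1\}$: chosen at iteration $k$ by one of two rules. Fixed rule: $\mathcal I^k=\mathcal I_{\rm fix}$ for all $k$, for a prescribed $\mathcal I_{\rm fix}\subset\{0,\ldots,N-1\}$. Adaptive rule: $\mathcal I^0=\emptyset$, and for $k\ge1$, with $\Delta\mathbf U^k:=\mathbf U^k-\mathbf U^{k-1}$ and $a_\ell^k:=\|\widehat{\Delta\mathbf U}_\ell^k\|_2^2$, $\mathcal I^k$ is the union of the $M$ conjugate groups $\{\ell,(N-\ell)\bmod N\}$ with the largest combined energies $a_\ell^k$, $M$ being a prescribed number. Mixed Fourier space: with the discrepancy histories $\mathbf d_n^m:=\mathcal D_n(\mathbf U_n^m)$, $\mathcal V_{\rm mix}^k(\mathcal I^k):=\mathcal V_{\rm sol}^k(\mathcal I^k)+\mathcal V_{\rm disc}^k(\mathcal I^k)\subset\mathbb R^d$, where $\mathcal V_{\rm sol}^k(\mathcal I^k)$ is the real span of $\{\operatorname{Re}\widehat{\mathbf U}_\ell^m,\operatorname{Im}\widehat{\mathbf U}_\ell^m:\ell\in\mathcal I^k,\ 0\le m\le k\}$ and $\mathcal V_{\rm disc}^k(\mathcal I^k)$ is the real span of $\{\operatorname{Re}\widehat{\mathbf d}_\ell^m,\operatorname{Im}\widehat{\mathbf d}_\ell^m:\ell\in\mathcal I^k,\ 0\le m\le k\}$. Tail and leak: for a history $\mathbf w$, a mode set $\mathcal I$ and an orthogonal projection $P$ (extended complex-linearly to $\mathbb C^d$ by $P(\mathbf a+\imath\mathbf b):=P\mathbf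 a+\imath P\mathbf b$, with the Euclidean norm on $\mathbb C^d$), $\operatorname{Tail}_{\mathcal I}(\mathbf w):=\sum_{\ell\notin\mathcal I}\|\widehat{\mathbf w}_\ell\|_2$ and $\operatorname{Leak}_{\mathcal I}^P(\mathbf w):=\sum_{\ell\in\mathcal I}\|(I-P)\widehat{\mathbf w}_\ell\|_2$. Ratios and weight (for $E_\infty^k>0$): $$\Theta_Q^k:=\frac{\operatorname{Tail}_{\mathcal I^k}(\mathbf e^k)+\operatorname{Leak}_{\mathcal I^k}^{P_{\mathcal I^k}}(\mathbf e^k)}{\sqrt N\,E_\infty^k},\qquad \Theta_P^k:=\frac{\max_{0\le n<N}\|P_{\mathcal I^k}\mathbf e_n^k\|_2}{E_\infty^k},$$ $$U_k^\perp(P_{\mathcal I^k}):=\max_{0\le n<N}\|(I-P_{\mathcal I^k})\mathbf U_n^k\|_2 .$$ *)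

(* Defs.v *)
From HB Require Import structures.
From mathcomp Require Import all_boot all_order all_algebra.
From mathcomp Require Import complex.
From mathcomp Require Import all_classical all_reals all_analysis.

Set Implicit Arguments.
Unset Strict Implicit.
Unset Printing Implicit Defensive.

Import Order.TTheory GRing.Theory Num.Theory.
Import numFieldNormedType.Exports.

Local Open Scope classical_set_scope.
Local Open Scope ring_scope.

(* States are row vectors and matrices act on the right, x |-> x *m A; in
   particular the derivative of f at x in the direction w is w *m 'J f x.
   This is the transpose of the column-vector convention, so products of
   Jacobians appear in reversed order; spectral norms and eigenvalues are
   unaffected. *)

Notation history R N d := {ffun 'I_N -> 'rV[R]_d}.

(* The norm canonically attached to 'rV[R]_d is the max norm, so the Euclidean
   norm is defined here. Both induce the same topology, hence the same notions
   of openness, continuity and Frechet differentiability. *)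
Definition enorm (R : realType) (d : nat) (x : 'rV[R]_d) : R :=
  Num.sqrt (\sum_(j < d) x 0 j ^+ 2).

Definition cenorm (R : realType) (d : nat) (z : 'rV[R[i]]_d) : R :=
  Num.sqrt (\sum_(j < d) (complex.Re (z 0 j) ^+ 2 + complex.Im (z 0 j) ^+ 2)).

Definition specnorm (R : realType) (d : nat) (A : 'M[R]_d) : R :=
  sup [set enorm (x *m A) / enorm x | x in [set x : 'rV[R]_d | x != 0]].

Definition hnorm (R : realType) (N d : nat) (w : history R N d) : R :=
  \big[Num.max/0]_(n < N) enorm (w n).

Definition opnorm (R : realType) (N d : nat) (S : 'End(history R N d)) : R :=
  sup [set hnorm (S w) / hnorm w | w in [set w : history R N d | w != 0]].

Definition map_history (R : realType) (N d : nat)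
    (g : 'I_N -> 'rV[R]_d -> 'rV[R]_d) (w : history R N d) : history R N d :=
  [ffun n => g n (w n)].

Definition periodic_rhs (R : realType) (d : nat) (T : R)
    (Omega : set 'rV[R]_d) (f : 'rV[R]_d -> R -> 'rV[R]_d) : Prop :=
  [/\ forall x t, Omega x -> f x (t + T) = f x t,
      {within Omega `*` [set: R],
        continuous (fun p : 'rV[R]_d * R => f p.1 p.2)},
      forall x t, Omega x -> differentiable (f ^~ t) x &
      {within Omega `*` [set: R],
        continuous (fun p : 'rV[R]_d * R => 'J (f ^~ p.2) p.1)}].

Definition C1_near (R : realType) (d : nat) (B : set 'rV[R]_d)
    (g : 'rV[R]_d -> 'rV[R]_d) : Prop :=
  exists O : set 'rV[R]_d, [/\ open O, B `<=` O &
    forall x, O x -> differentiable g x /\ {for x, continuous (jacobian g)}].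

Definition discr (R : realType) (N d : nat)
    (F G : 'I_N -> 'rV[R]_d -> 'rV[R]_d) (n : 'I_N) (x : 'rV[R]_d) : 'rV[R]_d :=
  F n x - G n x.

Definition hprop (R : realType) (N d : nat)
    (F G : 'I_N -> 'rV[R]_d -> 'rV[R]_d) (P : 'M[R]_d)
    (n : 'I_N) (x : 'rV[R]_d) : 'rV[R]_d :=
  G n x + discr F G n (x *m P).

Definition fine_periodic (R : realType) (N d : nat)
    (F : 'I_N -> 'rV[R]_d -> 'rV[R]_d) (u : history R N d) : Prop :=
  forall n : 'I_N, u (ordS n) = F n (u n).

Section Cyclic.
Variables (R : realType) (N d : nat) (F G : 'I_N -> 'rV[R]_d -> 'rV[R]_d).
Variables (P : 'M[R]_d) (u : history R N d).

Definition cyclic_fun (w : history R N d) : history R N d :=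
  [ffun n => w n
             - w (ord_pred n) *m 'J (hprop F G P (ord_pred n)) (u (ord_pred n))].

Lemma cyclic_fun_is_linear : linear cyclic_fun.
Proof.
move=> a v w; apply/ffunP => n; rewrite !ffunE.
by rewrite mulmxDl -scalemxAl scalerBr opprD addrACA.
Qed.

HB.instance Definition _ :=
  GRing.isLinear.Build R (history R N d) (history R N d) _ cyclic_fun
    cyclic_fun_is_linear.

Definition cyclic_op : 'End(history R N d) := linfun cyclic_fun.

Lemma cyclic_opE (w : history R N d) (n : 'I_N) :
  cyclic_op w (ordS n) = w (ordS n) - w n *m 'J (hprop F G P n) (u n).
Proof. by rewrite lfunE/= ffunE ordSK. Qed.

Definition monodromy : 'M[R]_d :=
  \big[mulmx/1%:M]_(n < N) 'J (hprop F G P n) (u n).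

(* inv_lfun is a total pseudo-inverse: it is the inverse of cyclic_op exactly
   when cyclic_op is bijective, i.e. when 1 is not an eigenvalue of
   monodromy. *)
Definition gammahat : R := opnorm (cyclic_op^-1)%VF.

End Cyclic.

Definition cis (R : realType) (t : R) : R[i] := Complex (cos t) (sin t).

Definition fourier (R : realType) (N d : nat) (w : history R N d) (l : 'I_N) :
    'rV[R[i]]_d :=
  real_complex R (Num.sqrt N%:R)^-1 *:
    \sum_(n < N) cis (- (2 * pi * l%:R * n%:R / N%:R)) *:
      map_mx (real_complex R) (w n).

Definition conj_group (N : nat) (l : 'I_N) : {set 'I_N} :=
  [set j : 'I_N | (j == l) || (val j == (N - l) %% N)%N].

Definition conj_groups (N : nat) : {set {set 'I_N}} :=
  [set conj_group l | l : 'I_N].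

Definition mode_energy (R : realType) (N d : nat)
    (U : nat -> history R N d) (m : nat) (l : 'I_N) : R :=
  cenorm (fourier (U m - U m.-1) l) ^+ 2.

(* Ties between equally energetic groups may be broken in any way. *)
Definition top_energy_modes (R : realType) (N d : nat) (M : nat)
    (U : nat -> history R N d) (m : nat) (J : {set 'I_N}) : Prop :=
  exists S : {set {set 'I_N}},
    [/\ S \subset conj_groups N, #|S| = M,
        forall g h, g \in S -> h \in conj_groups N -> h \notin S ->
          \sum_(l in h) mode_energy U m l <= \sum_(l in g) mode_energy U m l &
        J = finset.cover S].

Variant mode_rule (N : nat) := Fixed of {set 'I_N} | Adaptive of nat.

Definition mode_selection (R : realType) (N d : nat) (r : mode_rule N)
    (U : nat -> history R N d) (m : nat) (J : {set 'I_N}) : Prop :=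
  match r with
  | Fixed J0 => J = J0
  | Adaptive M => if m is 0%N then J = finset.set0 else top_energy_modes M U m J
  end.

(* Subspaces of R^d are represented as row spaces of matrices. *)
Definition mode_space (R : realType) (N d : nat) (W : nat -> history R N d)
    (J : {set 'I_N}) (k : nat) : 'M[R]_d :=
  (\sum_(l in J) \sum_(m < k.+1)
     (map_mx (@complex.Re R) (fourier (W m) l)
      + map_mx (@complex.Im R) (fourier (W m) l)))%MS.

Definition mixed_space (R : realType) (N d : nat)
    (F G : 'I_N -> 'rV[R]_d -> 'rV[R]_d) (U : nat -> history R N d)
    (J : {set 'I_N}) (k : nat) : 'M[R]_d :=
  (mode_space U J k
   + mode_space (fun m => map_history (discr F G) (U m)) J k)%MS.

(* Projection onto the row space of A along its Euclidean orthogonal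
   complement. *)
Definition orthoproj (R : realType) (m d : nat) (A : 'M[R]_(m, d)) : 'M[R]_d :=
  proj_mx <<A>>%MS (orthomx idfun 1%:M A).

Definition fourier_proj (R : realType) (N d : nat)
    (F G : 'I_N -> 'rV[R]_d -> 'rV[R]_d) (U : nat -> history R N d)
    (J : {set 'I_N}) (k : nat) : 'M[R]_d :=
  orthoproj (mixed_space F G U J k).

Definition pppc_update (R : realType) (N d : nat)
    (F G : 'I_N -> 'rV[R]_d -> 'rV[R]_d) (P : 'M[R]_d)
    (V V' : history R N d) : Prop :=
  forall n : 'I_N,
    V' (ordS n) = F n (V n) + hprop F G P n (V' n) - hprop F G P n (V n).

Section Ratios.
Variables (R : realType) (N d : nat).
Implicit Types (J : {set 'I_N}) (P : 'M[R]_d) (w e : history R N d).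

Definition tail_sum J w : R := \sum_(l | l \notin J) cenorm (fourier w l).

Definition leak J P w : R :=
  \sum_(l in J)
    cenorm (fourier w l *m map_mx (real_complex R) (1%:M - P)).

Definition thetaQ J P e : R :=
  (tail_sum J e + leak J P e) / (Num.sqrt N%:R * hnorm e).

Definition thetaP P e : R :=
  (\big[Num.max/0]_(n < N) enorm (e n *m P)) / hnorm e.

Definition Uperp P w : R :=
  \big[Num.max/0]_(n < N) enorm (w n *m (1%:M - P)).

Definition rhoF (Gam mu nu kappa rad : R) J P w e : R :=
  Gam / (1 - 2^-1 * Gam * kappa * rad) *
  (mu * thetaQ J P e + nu * Uperp P w * thetaP P e
   + nu / 2 * thetaQ J P e * thetaP P e * hnorm e).

End Ratios.

(* Main.v *)
From HB Require Import structures.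
Require Import Defs.
From mathcomp Require Import all_boot all_order all_algebra.
From mathcomp Require Import complex ring lra.
From mathcomp Require Import all_classical all_reals all_analysis.
Import Order.TTheory GRing.Theory Num.Theory numFieldNormedType.Exports.
Local Open Scope classical_set_scope.
Local Open Scope ring_scope.

Set Implicit Arguments.
Unset Strict Implicit.
Unset Printing Implicit Defensive.

(** Let [e] and [e'] be the errors before and after the update, [J_n] the
    Jacobian of [H_n] at [u_n], and [Q = 1 - P]. Subtracting the update from the
    periodicity relation [u_(n+1) = F_n u_n] gives
<<
      e'_(n+1) - e'_n J_n =   (H_n u_n - H_n V'_n - e'_n J_n)
                            + (r_n u_n - r_n V_n),
>>
    where [r_n x = F_n x - H_n x = D_n x - D_n (x P)].

    The left-hand side is the cyclic operator applied to [e']. It is injective,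
    because a history in its kernel gives a fixed vector of the monodromy matrix;
    hence [|e'|] is at most [Gamma] times the norm of the right-hand side.

    The first bracket is a Taylor remainder, at most [kappa / 2 |e'|^2] and hence
    at most [kappa rad / 2 |e'|]; by the smallness condition, [Gamma] times it can
    be absorbed on the left ([taylor_remainder_le]).

    In the second bracket, [r_n] measures how [D_n] changes when a state is
    projected, so its increment involves [e_n] mostly through [e_n Q]:
    [compl_increment_le] bounds it by
    [mu |e_n Q| + nu (|V_n Q| + |e_n Q| / 2) |e_n P|].

    Finally [e_n Q] is recovered from the temporal Fourier coefficients of [e] by
    the inversion formula. As [Q] is a contraction ([orthoproj_compl_contraction]),
    the selected modes contribute their leak and the others their full norm, so
    [|e_n Q| <= (tail + leak) / sqrt N] ([enorm_compl_le_tail_leak]), which is the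
    first ratio times the norm of [e]. *)

(** * Euclidean and operator norms *)

Section Euclidean.
Variables (R : realType) (d : nat).
Implicit Types (x y z : 'rV[R]_d).

Definition dotr x y : R := (x *m y^T) 0 0.

Lemma dotrE x y : dotr x y = \sum_j x 0 j * y 0 j.
Proof. by rewrite /dotr mxE; apply: eq_bigr => j _; rewrite mxE. Qed.

Lemma dotrC x y : dotr x y = dotr y x.
Proof. by rewrite !dotrE; apply: eq_bigr => j _; rewrite mulrC. Qed.

Lemma dotrDl x y z : dotr (x + y) z = dotr x z + dotr y z.
Proof. by rewrite /dotr mulmxDl mxE. Qed.

Lemma dotrBl x y z : dotr (x - y) z = dotr x z - dotr y z.
Proof. by rewrite /dotr mulmxBl !mxE. Qed.

Lemma dotrZl a x y : dotr (a *: x) y = a * dotr x y.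
Proof. by rewrite /dotr -scalemxAl mxE. Qed.

Lemma enorm_ge0 x : 0 <= enorm x. Proof. exact: sqrtr_ge0. Qed.

Lemma enorm_sqr x : enorm x ^+ 2 = dotr x x.
Proof.
rewrite sqr_sqrtr ?dotrE //; last by apply: sumr_ge0 => j _; exact: sqr_ge0.
Qed.

Lemma le_coord_enorm x j : `|x 0 j| <= enorm x.
Proof.
rewrite -sqrtr_sqr ler_wsqrtr // (bigD1 j) //= lerDl.
by apply: sumr_ge0 => i _; exact: sqr_ge0.
Qed.

Lemma enorm0_eq0 x : enorm x = 0 -> x = 0.
Proof.
move=> x0; apply/rowP => j; rewrite mxE; apply/eqP.
by rewrite -normr_le0 -x0 le_coord_enorm.
Qed.

Lemma enorm_gt0 x : x != 0 -> 0 < enorm x.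
Proof.
by move=> x0; rewrite lt0r enorm_ge0 andbT; apply: contra_neq x0 => /enorm0_eq0.
Qed.

Lemma enormZ a x : enorm (a *: x) = `|a| * enorm x.
Proof.
apply/eqP; rewrite -(@eqrXn2 _ 2) ?mulr_ge0 ?enorm_ge0 //.
by rewrite exprMn !enorm_sqr real_normK ?num_real // dotrZl dotrC dotrZl mulrA.
Qed.

Lemma enorm0 : enorm (0 : 'rV[R]_d) = 0.
Proof. by rewrite -(scale0r 0) enormZ normr0 mul0r. Qed.

Lemma enormN x : enorm (- x) = enorm x.
Proof. by rewrite -scaleN1r enormZ normrN1 mul1r. Qed.

Lemma cauchy_schwarz x y : dotr x y <= enorm x * enorm y.
Proof.
have [->|x0] := eqVneq x 0; first by rewrite /dotr mul0mx mxE enorm0 mul0r.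
have [->|y0] := eqVneq y 0.
  by rewrite dotrC /dotr mul0mx mxE enorm0 mulr0.
have ab : 0 < enorm x * enorm y by rewrite mulr_gt0 ?enorm_gt0.
(* expand 0 <= |(|y| x - |x| y)|^2 = 2 |x| |y| (|x| |y| - <x, y>) *)
rewrite -(ler_pM2l ab) -subr_ge0.
have := sqr_ge0 (enorm (enorm y *: x - enorm x *: y)).
rewrite enorm_sqr dotrBl (dotrC (enorm y *: x)) (dotrC (enorm x *: y)) !dotrBl.
rewrite !dotrZl !(dotrC _ (_ *: _)) !dotrZl -!enorm_sqr (dotrC y x) => h.
nra.
Qed.

Lemma ler_enormD x y : enorm (x + y) <= enorm x + enorm y.
Proof.
rewrite -(@ler_pXn2r _ 2) ?nnegrE ?addr_ge0 ?enorm_ge0 //.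
rewrite sqrrD !enorm_sqr dotrDl (dotrC x) (dotrC y) !dotrDl (dotrC y x).
by have := cauchy_schwarz x y; lra.
Qed.

Lemma ler_enorm_sum (I : Type) (r : seq I) (p : pred I) (v : I -> 'rV[R]_d) :
  enorm (\sum_(i <- r | p i) v i) <= \sum_(i <- r | p i) enorm (v i).
Proof.
elim/big_ind2: _ => [|a x b y ax b_y|//]; first by rewrite enorm0.
exact: le_trans (ler_enormD _ _) (lerD ax b_y).
Qed.

End Euclidean.

Section OperatorNorms.
Variables (R : realType) (N d : nat).
Implicit Types (w : history R N d) (S : 'End(history R N d)).

(** Common to [specnorm] and [opnorm]. Some bound [C] on the quotients has to be
    known, because the [sup] of an unbounded set is 0 by convention. *)
Lemma sup_quotient_ge (V : Type) (num den : V -> R) (D : set V) (C : R) (x : V) :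
  (forall y, D y -> 0 < den y) -> (forall y, D y -> num y <= C * den y) -> D x ->
  num x <= sup [set num y / den y | y in D] * den x.
Proof.
move=> den0 numC Dx; rewrite -ler_pdivrMr ?den0 //; apply: ub_le_sup.
  by exists C => _ [y Dy <-]; rewrite ler_pdivrMr ?den0 // numC.
by exists x.
Qed.

Lemma le_specnorm (A : 'M[R]_d) (x : 'rV[R]_d) :
  enorm (x *m A) <= specnorm A * enorm x.
Proof.
have [->|x0] := eqVneq x 0; first by rewrite mul0mx enorm0 mulr0.
apply: (@sup_quotient_ge _ (fun x => enorm (x *m A)) _ _
  (\sum_j enorm (row j A))) => // y; first exact: enorm_gt0.
(* the sum of the norms of the rows of A bounds the quotients *)
move=> _; rewrite mulmx_sum_row mulr_suml; apply: le_trans (ler_enorm_sum _ _ _) _.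
by apply: ler_sum => j _; rewrite enormZ mulrC ler_wpM2l ?enorm_ge0 ?le_coord_enorm.
Qed.

Lemma le_enorm_hnorm w n : enorm (w n) <= hnorm w.
Proof. exact: le_bigmax. Qed.

Lemma hnorm_ge0 w : 0 <= hnorm w.
Proof. exact: bigmax_ge_id. Qed.

Lemma hnorm_le w a : 0 <= a -> (forall n, enorm (w n) <= a) -> hnorm w <= a.
Proof. by move=> a0 wa; apply: bigmax_le. Qed.

Lemma hnorm0_eq0 w : hnorm w = 0 -> w = 0.
Proof.
move=> w0; apply/ffunP => n; rewrite ffunE; apply: enorm0_eq0; apply: le_anti.
by rewrite enorm_ge0 -w0 le_enorm_hnorm.
Qed.

Lemma hnormD v w : hnorm (v + w) <= hnorm v + hnorm w.
Proof.
apply: hnorm_le => [|n]; first by rewrite addr_ge0 ?hnorm_ge0.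
by rewrite ffunE (le_trans (ler_enormD _ _)) ?lerD ?le_enorm_hnorm.
Qed.

Lemma hnormZ a w : hnorm (a *: w) <= `|a| * hnorm w.
Proof.
apply: hnorm_le => [|n]; first by rewrite mulr_ge0 ?hnorm_ge0.
by rewrite ffunE enormZ ler_wpM2l ?le_enorm_hnorm.
Qed.

Lemma hnorm_sum (I : Type) (r : seq I) (v : I -> history R N d) :
  hnorm (\sum_(i <- r) v i) <= \sum_(i <- r) hnorm (v i).
Proof.
elim/big_ind2: _ => [|a x b y ax b_y|//].
  by apply: hnorm_le => // n; rewrite ffunE enorm0.
exact: le_trans (hnormD _ _) (lerD ax b_y).
Qed.

Let unit_history (n : 'I_N) (j : 'I_d) : history R N d :=
  [ffun m => if m == n then delta_mx 0 j else 0].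

Lemma history_sum_delta w :
  w = \sum_n \sum_j w n 0 j *: unit_history n j.
Proof.
apply/ffunP => m; rewrite sum_ffunE (bigD1 m) //= sum_ffunE.
rewrite [X in _ + X]big1 ?addr0 => [|n nm].
  rewrite {1}(row_sum_delta (w m)); apply: eq_bigr => j _.
  by rewrite !ffunE eqxx.
by rewrite sum_ffunE big1 // => j _; rewrite !ffunE eq_sym (negPf nm) scaler0.
Qed.

(** Operators on histories are bounded because the space is finite-dimensional:
    the norms of the images of the coordinate histories add up to a bound. *)
Lemma le_opnorm S w : hnorm (S w) <= opnorm S * hnorm w.
Proof.
have hn0 : hnorm (0 : history R N d) <= 0.
  by apply: hnorm_le => // n; rewrite ffunE enorm0.
have [->|w0] := eqVneq w 0.
  rewrite linear0 (le_trans hn0) //.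
  by rewrite (_ : hnorm 0 = 0) ?mulr0 //; apply: le_anti; rewrite hn0 hnorm_ge0.
apply: (@sup_quotient_ge _ (fun w => hnorm (S w)) _ _
  (\sum_n \sum_j hnorm (S (unit_history n j)))) => // v.
  by move=> v0; rewrite lt0r hnorm_ge0 andbT; apply: contra_neq v0 => /hnorm0_eq0.
move=> _; rewrite {1}(history_sum_delta v) linear_sum mulr_suml.
apply: le_trans (hnorm_sum _ _) _; apply: ler_sum => n _.
rewrite linear_sum mulr_suml; apply: le_trans (hnorm_sum _ _) _.
apply: ler_sum => j _; rewrite linearZ; apply: le_trans (hnormZ _ _) _.
rewrite mulrC ler_wpM2l ?hnorm_ge0 // (le_trans (le_coord_enorm _ _)) //.
exact: le_enorm_hnorm.
Qed.

Lemma opnorm_ge0 S : 0 <= opnorm S.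
Proof.
have [[w /eqP w0]|] := pselect (exists w : history R N d, w <> 0).
  have hw : 0 < hnorm w.
    by rewrite lt0r hnorm_ge0 andbT; apply: contra_neq w0 => /hnorm0_eq0.
  by rewrite -(pmulr_lge0 _ hw) (le_trans _ (le_opnorm S w)) ?hnorm_ge0.
(* no nonzero history exists when d = 0 or N = 0, and sup set0 = 0 *)
move=> w0; rewrite /opnorm (_ : [set _ | _ in _] = set0) ?sup0 //.
by rewrite -subset0 => _ [w /= /eqP wn0 _]; case: w0; exists w.
Qed.

End OperatorNorms.

(** * Orthogonal projections are contractions *)

Section OrthogonalProjection.
Variables (R : realType) (d m : nat) (A : 'M[R]_(m, d)).

Let A_perp : 'M[R]_d := orthomx idfun 1%:M A.

Lemma orthomx_dotr (x y : 'rV[R]_d) :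
  (x <= A)%MS -> (y <= A_perp)%MS -> dotr x y = 0.
Proof.
move=> /submxP[a ->] /sub_kermxP; rewrite mul1mx map_mx_id // => yA.
by rewrite dotrC /dotr trmx_mul mulmxA yA mul0mx mxE.
Qed.

Lemma orthomx_capmx : (A :&: A_perp = 0)%MS.
Proof.
apply/eqP; rewrite -submx0; apply/rV_subP => x; rewrite sub_capmx => /andP[xA xA'].
by rewrite (@enorm0_eq0 _ _ x) ?sub0mx //; apply/eqP;
  rewrite -sqrf_eq0 enorm_sqr orthomx_dotr.
Qed.

(** Positive definiteness makes a subspace meet its orthogonal complement
    trivially, so their ranks add up to the dimension of the whole space. *)
Lemma orthomx_addsmx (x : 'rV[R]_d) : (x <= A + A_perp)%MS.
Proof.
apply: submx_full; rewrite /row_full eqn_leq rank_leq_col /=.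
have := mxrank_sum_cap A A_perp; rewrite orthomx_capmx mxrank0 addn0 => ->.
rewrite /A_perp /orthomx mxrank_ker mul1mx map_mx_id // mxrank_tr.
by rewrite subnKC // rank_leq_col.
Qed.

Lemma dotr_orthoproj (x : 'rV[R]_d) :
  dotr (x *m orthoproj A) (x *m (1%:M - orthoproj A)) = 0.
Proof.
apply: orthomx_dotr; first by rewrite -(genmxE A) proj_mx_sub.
rewrite mulmxBr mulmx1 proj_mx_compl_sub //.
by rewrite (adds_eqmx (genmxE A) (eqmx_refl _)) orthomx_addsmx.
Qed.

(** Pythagoras: with [P = orthoproj A], [x] is the sum of the orthogonal vectors
    [x P] and [x (1 - P)]. *)
Lemma orthoproj_compl_contraction (x : 'rV[R]_d) :
  enorm (x *m (1%:M - orthoproj A)) <= enorm x.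
Proof.
set y := x *m orthoproj A; set z := x *m _.
have -> : x = y + z by rewrite /y /z mulmxBr mulmx1 addrC subrK.
rewrite -(@ler_pXn2r _ 2) ?nnegrE ?enorm_ge0 // !enorm_sqr dotrDl.
rewrite (dotrC y) (dotrC z (y + z)) !dotrDl (dotrC z y) dotr_orthoproj addr0 add0r.
by rewrite lerDr -enorm_sqr sqr_ge0.
Qed.

End OrthogonalProjection.

(** * Temporal Fourier inversion, tail and leak *)

Section FourierInversion.
Variable (R : realType).
Local Notation rc := (real_complex R).

Lemma cisD (a b : R) : cis (a + b) = cis a * cis b.
Proof.
rewrite /cis cosD sinD; apply/eqP; rewrite eq_complex /= eqxx.
by rewrite [X in X == _]addrC [X in _ + X]mulrC eqxx.
Qed.

Lemma cis0 : cis (0 : R) = 1.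
Proof. by rewrite /cis cos0 sin0. Qed.

Lemma cisN (a : R) : cis (- a) = (cis a)^-1.
Proof.
have h : cis a * cis (- a) = 1 by rewrite -cisD subrr cis0.
have c0 : cis a != 0.
  by apply: contra_eq_neq h => ->; rewrite mul0r eq_sym oner_neq0.
by apply: (mulfI c0); rewrite h divff.
Qed.

Lemma cis_natM (n : nat) (a : R) : cis (n%:R * a) = cis a ^+ n.
Proof.
elim: n => [|n IH]; first by rewrite mul0r cis0 expr0.
by rewrite -natr1 mulrDl mul1r cisD IH exprSr.
Qed.

(** [Re (cis a) = 1 - 2 sin^2 (a / 2)], and the half angle lies
    strictly between 0 and pi. *)
Lemma cis_neq1 (a : R) : 0 < a < 2 * pi -> cis a != 1.
Proof.
move=> /andP[a0 a2]; rewrite eq_complex /= negb_and; apply/orP; left.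
have -> : a = a / 2 + a / 2 by lra.
rewrite cosD -!expr2 cos2sin2; have : 0 < sin (a / 2) by apply: sin_gt0_pi; lra.
by move=> s0; apply/eqP => h; nra.
Qed.

Lemma prim_root_cis (N : nat) :
  (0 < N)%N -> N.-primitive_root (cis (2 * pi / N%:R : R)).
Proof.
move=> N0; have N0' : 0 < N%:R :> R by rewrite ltr0n.
apply/andP; split=> //; apply/forallP => i; apply/eqP.
rewrite unity_rootE -cis_natM; case: (eqVneq i.+1 N) => [->|iN].
  rewrite (_ : _ * _ = pi *+ 2) ?/cis ?cos2pi ?sin2pi; last first.
    by rewrite mulr2n; field; rewrite gt_eqF.
  by rewrite !eqxx.
apply/negbTE/cis_neq1; rewrite mulrA; apply/andP; split.
  by rewrite !mulr_gt0 ?invr_gt0 ?pi_gt0.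
rewrite ltr_pdivrMr // mulrC ltr_pM2l ?mulr_gt0 ?pi_gt0 // ltr_nat.
by rewrite ltn_neqAle iN ltn_ord.
Qed.

(** Orthogonality of the characters of Z/N: off the diagonal the sum is
    geometric, of ratio an N-th root of unity other than 1. *)
Lemma sum_cis (N : nat) (n m : 'I_N) :
  \sum_(l < N) cis (2 * pi * l%:R * n%:R / N%:R : R)
               * cis (- (2 * pi * l%:R * m%:R / N%:R))
  = if m == n then N%:R else 0.
Proof.
have N0 : (0 < N)%N by apply: leq_ltn_trans (ltn_ord n).
set om := cis (2 * pi / N%:R : R).
have om0 : om != 0.
  have := prim_expr_order (@prim_root_cis N N0).
  rewrite -/om; apply: contra_eq_neq => ->.
  by rewrite expr0n gtn_eqF // eq_sym oner_neq0.
have omE (l j : 'I_N) : cis (2 * pi * l%:R * j%:R / N%:R : R) = (om ^+ j) ^+ l.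
  by rewrite -exprM mulnC -cis_natM natrM; congr cis; ring.
have -> : \sum_(l < N) cis (2 * pi * l%:R * n%:R / N%:R : R)
   * cis (- (2 * pi * l%:R * m%:R / N%:R)) = \sum_(l < N) (om ^+ n / om ^+ m) ^+ l.
  by apply: eq_bigr => l _; rewrite cisN !omE expr_div_n.
have [->|mn] := eqVneq m n.
  rewrite divff ?expf_neq0 //; under eq_bigr do rewrite expr1n.
  by rewrite sumr_const card_ord.
have q1 : om ^+ n / om ^+ m != 1.
  rewrite -[1](divff (expf_neq0 m om0)).
  apply: contra_neq mn => /(mulIf (invr_neq0 (expf_neq0 m om0)))/eqP.
  rewrite (eq_prim_root_expr (@prim_root_cis N N0)) !modn_small //.
  by move=> /eqP nm; apply/val_inj.
apply: (mulfI (_ : om ^+ n / om ^+ m - 1 != 0)); first by rewrite subr_eq0.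
rewrite -subrX1 expr_div_n -!exprM !(mulnC _ N) !exprM.
by rewrite (prim_expr_order (@prim_root_cis N N0)) !expr1n divr1 subrr mulr0.
Qed.

Variables (N d : nat).

Lemma fourier_inversion (w : history R N d) (n : 'I_N) :
  map_mx rc (w n) = rc (Num.sqrt N%:R)^-1 *:
    \sum_(l < N) cis (2 * pi * l%:R * n%:R / N%:R) *: fourier w l.
Proof.
have N0 : (0 < N)%N by apply: leq_ltn_trans (ltn_ord n).
under eq_bigr => l _ do rewrite /fourier scalerA mulrC -scalerA scaler_sumr.
rewrite -scaler_sumr scalerA -rmorphM /= -invfM -expr2 sqr_sqrtr ?ler0n //.
rewrite exchange_big /= (bigD1 n) //= [X in _ + X]big1 => [|m mn].
  rewrite addr0; under eq_bigr do rewrite scalerA.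
  rewrite -scaler_suml sum_cis eqxx scalerA.
  rewrite -(rmorph_nat rc N) -rmorphM /= mulVf ?rmorph1 ?scale1r //.
  by rewrite pnatr_eq0 -lt0n.
under eq_bigr do rewrite scalerA.
by rewrite -scaler_suml sum_cis (negPf mn) scale0r.
Qed.

End FourierInversion.

Section ComplexNorm.
Variables (R : realType) (d : nat).
Implicit Types (z y : 'rV[R[i]]_d) (x : 'rV[R]_d).
Local Notation rc := (real_complex R).
Local Notation Rep := (map_mx (@complex.Re R)).
Local Notation Imp := (map_mx (@complex.Im R)).

(** Gives [cenorm] the triangle inequality of [enorm] in dimension [d + d]. *)
Lemma cenormE z : cenorm z = enorm (row_mx (Rep z) (Imp z)).
Proof.
rewrite /cenorm /enorm big_split_ord big_split /=; congr (Num.sqrt (_ + _));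
by apply: eq_bigr => j _; rewrite ?row_mxEl ?row_mxEr mxE.
Qed.

Lemma cenorm_sqr z : cenorm z ^+ 2 = enorm (Rep z) ^+ 2 + enorm (Imp z) ^+ 2.
Proof. by rewrite cenormE !enorm_sqr /dotr tr_row_mx mul_row_col mxE. Qed.

Lemma cenorm_ge0 z : 0 <= cenorm z.
Proof. by rewrite cenormE enorm_ge0. Qed.

Lemma ler_cenormD z y : cenorm (z + y) <= cenorm z + cenorm y.
Proof.
rewrite !cenormE (_ : row_mx _ _ = row_mx (Rep z) (Imp z) + row_mx (Rep y) (Imp y)).
  exact: ler_enormD.
rewrite add_row_mx; congr row_mx; apply/matrixP => i j; rewrite !mxE;
by case: (z i j) => ? ?; case: (y i j).
Qed.

Lemma ler_cenorm_sum (I : Type) (r : seq I) (p : pred I) (v : I -> 'rV[R[i]]_d) :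
  cenorm (\sum_(i <- r | p i) v i) <= \sum_(i <- r | p i) cenorm (v i).
Proof.
elim/big_ind2: _ => [|a x b y ax b_y|//].
  rewrite /cenorm big1 ?sqrtr0 // => j _.
  by rewrite mxE /= expr0n addr0.
exact: le_trans (ler_cenormD _ _) (lerD ax b_y).
Qed.

Lemma cenorm_cis (t : R) z : cenorm (cis t *: z) = cenorm z.
Proof.
congr Num.sqrt; apply: eq_bigr => j _; rewrite mxE.
case: (z 0 j) => a b /=; have := cos2Dsin2 t => cs.
rewrite -[RHS]mul1r -cs; ring.
Qed.

Lemma cenorm_real x : cenorm (map_mx rc x) = enorm x.
Proof. by congr Num.sqrt; apply: eq_bigr => j _; rewrite mxE /= expr0n addr0. Qed.

Lemma cenormZ_real (a : R) z : 0 <= a -> cenorm (rc a *: z) = a * cenorm z.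
Proof.
move=> a0; rewrite !cenormE -[a in RHS]ger0_norm // -enormZ scale_row_mx.
by congr (enorm (row_mx _ _)); apply/matrixP => i j; rewrite !mxE;
  case: (z i j) => ? ? /=; ring.
Qed.

Lemma cenorm_mul_contraction (Q : 'M[R]_d) z :
  (forall x, enorm (x *m Q) <= enorm x) -> cenorm (z *m map_mx rc Q) <= cenorm z.
Proof.
move=> Qc; rewrite -(@ler_pXn2r _ 2) ?nnegrE ?cenorm_ge0 // !cenorm_sqr.
have -> : Rep (z *m map_mx rc Q) = Rep z *m Q.
  apply/matrixP => i j; rewrite !mxE raddf_sum; apply: eq_bigr => l _.
  by rewrite !mxE; case: (z i l) => ? ? /=; ring.
have -> : Imp (z *m map_mx rc Q) = Imp z *m Q.
  apply/matrixP => i j; rewrite !mxE raddf_sum; apply: eq_bigr => l _.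
  by rewrite !mxE; case: (z i l) => ? ? /=; ring.
by apply: lerD; rewrite ler_pXn2r ?nnegrE ?enorm_ge0.
Qed.

End ComplexNorm.

(** The only place where temporal frequencies matter. By inversion, [w_n Q] with
    [Q = 1 - P] is [1 / sqrt N] times a sum over the modes of unimodular multiples
    of [w^_l Q]. On the modes of [J] the norms of these vectors sum to the leak; on
    the others [Q] is only known to be a contraction, which leaves the tail. *)
Lemma enorm_compl_le_tail_leak (R : realType) (N d : nat) (J : {set 'I_N})
    (P : 'M[R]_d) (w : history R N d) (n : 'I_N) :
  (forall x, enorm (x *m (1%:M - P)) <= enorm x) ->
  enorm (w n *m (1%:M - P)) <= (Num.sqrt N%:R)^-1 * (tail_sum J w + leak J P w).
Proof.
move=> Qc; rewrite -cenorm_real map_mxM fourier_inversion -scalemxAl mulmx_suml.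
rewrite cenormZ_real ?invr_ge0 ?sqrtr_ge0 // ler_wpM2l ?invr_ge0 ?sqrtr_ge0 //.
apply: le_trans (ler_cenorm_sum _ _ _) _.
rewrite (bigID (mem J)) /= addrC; apply: lerD; apply: ler_sum => l _;
by rewrite -scalemxAl cenorm_cis // cenorm_mul_contraction.
Qed.

(** * Mean value estimates *)

Section MeanValue.
Variables (R : realType) (d : nat).

Lemma is_derive_line (g : 'rV[R]_d -> 'rV[R]_d) (a w : 'rV[R]_d) (s : R) :
  differentiable g (a + s *: w) ->
  is_derive s 1 (fun t => g (a + t *: w)) (w *m 'J g (a + s *: w)).
Proof.
move=> dg.
have lineE : (fun h => h^-1 *: (((fun t => g (a + t *: w)) \o shift s) (h *: 1)
      - g (a + s *: w))) =
    (fun h => h^-1 *: ((g \o shift (a + s *: w)) (h *: w) - g (a + s *: w))).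
  apply/funext => h /=; congr (_ *: (g _ - _)).
  by rewrite -[h *: 1]/(h * 1) mulr1 scalerDl addrCA.
split; first by rewrite /derivable lineE; exact: diff_derivable.
by rewrite -deriveEjacobian // /derive lineE.
Qed.

Lemma is_derive_dotr (phi : R -> 'rV[R]_d) (dphi v : 'rV[R]_d) (s : R) :
  is_derive s 1 phi dphi -> is_derive s 1 (fun t => dotr (phi t) v) (dotr dphi v).
Proof.
move=> [phid <-]; rewrite derive_mx //.
have phij := (derivable_mxP phi s 1).1 phid.
have -> : (fun t => dotr (phi t) v) = \sum_j (v 0 j \*: (fun t => phi t 0 j)).
  apply/funext => t; rewrite dotrE fct_sumE; apply: eq_bigr => j _.
  by rewrite mulrC.
apply: is_derive_eq.
  by apply: is_derive_sum => j; apply: is_deriveZ; exact/derivableP/phij.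
by rewrite dotrE; apply: eq_bigr => j _; rewrite mxE mulrC.
Qed.

(** The mean value inequality with an affine bound on the speed replaces the
    integral of the speed. With [v = phi 1 - phi 0], apply the scalar mean value
    theorem to [<phi s, v> - |v| (a s + b s^2 / 2)], whose derivative is nonpositive
    by Cauchy-Schwarz: this yields [|v|^2 <= |v| (a + b / 2)]. *)
Lemma enorm_increment_le (phi dphi : R -> 'rV[R]_d) (a b : R) :
  (forall s : R, 0 <= s <= 1 -> is_derive s 1 phi (dphi s)) ->
  (forall s : R, 0 <= s <= 1 -> enorm (dphi s) <= a + b * s) ->
  enorm (phi 1 - phi 0) <= a + b / 2.
Proof.
move=> phid dle; set v := phi 1 - phi 0.
pose h s : R := dotr (phi s) v - enorm v * (a * s + b / 2 * s ^+ 2).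
pose dh s : R := dotr (dphi s) v - enorm v * (a + b * s).
have hd (s : R) : 0 <= s <= 1 -> is_derive s 1 h (dh s).
  move=> s01; apply: is_deriveB; first exact/is_derive_dotr/phid.
  apply: is_derive_eq; rewrite /GRing.scale /=; lra.
have [||c c01] := @MVT_segment R h dh 0 1 ler01.
- by move=> s /[!in_itv] /andP[/ltW s0 /ltW s1]; apply: hd; rewrite s0.
- apply: derivable_within_continuous => s /[!in_itv] s01.
  exact: (@ex_derive _ _ _ _ _ _ _ (hd _ s01)).
have {}c01 : 0 <= c <= 1 by move: c01; rewrite in_itv.
have dhc : dh c <= 0.
  rewrite /dh subr_le0 (le_trans (cauchy_schwarz _ _)) // mulrC.
  by rewrite ler_wpM2l ?enorm_ge0 ?dle.
rewrite subr0 mulr1 => hE; move: dhc; rewrite -hE /h.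
have -> : dotr (phi 1) v = dotr (phi 0) v + enorm v ^+ 2.
  by rewrite enorm_sqr -[in RHS](addrC (dotr v v)) -dotrDl subrK.
have := enorm_ge0 v; rewrite le_eqVlt => /predU1P[<- _|v0 hv].
  (* v = 0: the bound at the midpoint shows that a + b / 2 is nonnegative *)
  have := le_trans (enorm_ge0 _) (dle _ (_ : 0 <= 2^-1 <= 1)); lra.
by rewrite -(ler_pM2l v0); lra.
Qed.

Lemma is_derive_scale (v : 'rV[R]_d) (s : R) : is_derive s 1 ( *:%R^~ v) v.
Proof.
have dv : is_diff s ( *:%R^~ v) ( *:%R^~ v) by apply: is_diff_eq.
split; first exact/diff_derivable/ex_diff.
by rewrite deriveE ?diff_val ?scale1r //; exact: ex_diff.
Qed.

(** Along the segment from [x] to [y] the speed of the remainder is at most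
    [kappa (1 - s) |y - x|^2], because the Jacobian is frozen at the endpoint [y];
    the average of [1 - s] is the factor [1 / 2]. *)
Lemma taylor_remainder_le (g : 'rV[R]_d -> 'rV[R]_d) (B : set 'rV[R]_d)
    (kappa : R) (x y : 'rV[R]_d) :
  C1_near B g -> convex_set B -> B x -> B y ->
  (forall x y, B x -> B y ->
     specnorm ('J g x - 'J g y) <= kappa * enorm (x - y)) ->
  enorm (g y - g x - (y - x) *m 'J g y) <= kappa / 2 * enorm (y - x) ^+ 2.
Proof.
move=> [V [_ BV gV]] Bconv Bx By lip; set e := y - x.
have Bs (s : R) : 0 <= s <= 1 -> B (x + s *: e).
  move=> /andP[s0 s1].
  have := Bconv y x (Itv01 s0 s1) (mem_set By) (mem_set Bx) => /set_mem.
  congr (B _).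
  by rewrite -[LHS]/(s *: y + (1 - s) *: x) scalerBl scale1r /e scalerBr addrCA.
pose phi s : 'rV[R]_d := g (x + s *: e) - s *: (e *m 'J g y).
have -> : g y - g x - e *m 'J g y = phi 1 - phi 0.
  by rewrite /phi !scale1r !scale0r addr0 subr0 /e [x + _]addrC subrK addrAC.
have -> : kappa / 2 * enorm e ^+ 2
    = kappa * enorm e ^+ 2 + - (kappa * enorm e ^+ 2) / 2 by lra.
apply: (@enorm_increment_le phi
  (fun s => e *m 'J g (x + s *: e) - e *m 'J g y)) => s s01.
  apply: is_deriveB; first exact/is_derive_line/(gV _ (BV _ (Bs _ s01))).1.
  exact: is_derive_scale.
rewrite -mulmxBr (le_trans (le_specnorm _ _)) //.
have s1 : 0 <= 1 - s by case/andP: s01 => _; rewrite subr_ge0.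
have -> : kappa * enorm e ^+ 2 + - (kappa * enorm e ^+ 2) * s
    = kappa * ((1 - s) * enorm e) * enorm e by ring.
rewrite ler_wpM2r ?enorm_ge0 // (le_trans (lip _ _ (Bs _ s01) By)) //.
rewrite -[x + _ - y]opprB enormN (_ : y - _ = (1 - s) *: e) ?enormZ ?ger0_norm //.
by rewrite scalerBl scale1r /e opprD addrA.
Qed.

(** The increment of [x |-> g x - g (x P)]. Writing [e = e Q + e P] with
    [Q = 1 - P], its speed along [x + s e] splits into [e Q 'J g], controlled by
    [mu], and [e P] times a difference of Jacobians at [x + s e] and [(x + s e) P],
    two points at distance at most [|x Q| + s |e Q|]. *)
Lemma compl_increment_le (g : 'rV[R]_d -> 'rV[R]_d) (B : set 'rV[R]_d)
    (P : 'M[R]_d) (mu nu : R) (x e : 'rV[R]_d) :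
  C1_near B g -> 0 <= nu ->
  (forall s : R, 0 <= s <= 1 -> B (x + s *: e) /\ B ((x + s *: e) *m P)) ->
  (forall x, B x -> specnorm ('J g x) <= mu) ->
  (forall x y, B x -> B y ->
     specnorm ('J g x - 'J g y) <= nu * enorm (x - y)) ->
  enorm (g (x + e) - g ((x + e) *m P) - (g x - g (x *m P)))
    <= mu * enorm (e *m (1%:M - P))
       + nu * (enorm (x *m (1%:M - P)) + enorm (e *m (1%:M - P)) / 2)
         * enorm (e *m P).
Proof.
move=> [V [_ BV gV]] nu0 Bs bnd lip.
have PE (s : R) : (x + s *: e) *m P = x *m P + s *: (e *m P).
  by rewrite mulmxDl -scalemxAl.
pose phi s : 'rV[R]_d := g (x + s *: e) - g (x *m P + s *: (e *m P)).
have -> : g (x + e) - g ((x + e) *m P) - (g x - g (x *m P)) = phi 1 - phi 0.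
  by rewrite /phi !scale1r !scale0r !addr0 mulmxDl.
set q := enorm (e *m _); set r := enorm (x *m _); set p := enorm (e *m P).
have -> : mu * q + nu * (r + q / 2) * p = mu * q + nu * r * p + nu * q * p / 2.
  by ring.
apply: (@enorm_increment_le phi (fun s => e *m 'J g (x + s *: e)
  - (e *m P) *m 'J g (x *m P + s *: (e *m P)))) => s s01.
  have [B1 B2] := Bs s s01.
  apply: is_deriveB; apply: is_derive_line; first exact: (gV _ (BV _ B1)).1.
  by rewrite -PE; exact: (gV _ (BV _ B2)).1.
have [B1 B2] := Bs s s01; rewrite -PE.
set J1 := 'J g _; set J2 := 'J g _.
have -> : e *m J1 - e *m P *m J2 = e *m (1%:M - P) *m J1 + e *m P *m (J1 - J2).
  by rewrite mulmxBr mulmx1 mulmxBl mulmxBr addrA subrK.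
(* the affine speed bound, regrouped to display the Lipschitz estimate *)
have -> : mu * q + nu * r * p + nu * q * p * s
  = mu * q + nu * (r + s * q) * p by ring.
apply: le_trans (ler_enormD _ _) _; apply: lerD.
  by rewrite (le_trans (le_specnorm _ _)) // ler_wpM2r ?enorm_ge0 // bnd.
rewrite (le_trans (le_specnorm _ _)) // ler_wpM2r ?enorm_ge0 //.
rewrite (le_trans (lip _ _ B1 B2)) // ler_wpM2l //.
have -> : x + s *: e - (x + s *: e) *m P
  = x *m (1%:M - P) + s *: (e *m (1%:M - P)).
  by rewrite scalemxAl -mulmxDl mulmxBr mulmx1.
apply: le_trans (ler_enormD _ _) _.
by rewrite enormZ ger0_norm //; case/andP: s01.
Qed.

End MeanValue.

(** * Invertibility of the linearized cyclic operator *)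

(** Lets the products that define [monodromy] be split factor by factor. *)
HB.instance Definition _ (R : realType) (n : nat) :=
  Monoid.isLaw.Build 'M[R]_n 1%:M mulmx
    (@mulmxA R n n n n) (@mul1mx R n n) (@mulmx1 R n n).

Section CyclicInverse.
Variables (R : realType) (N d : nat) (F G : 'I_N -> 'rV[R]_d -> 'rV[R]_d).
Variables (P : 'M[R]_d) (u : history R N d).

(** A history annihilated by the cyclic operator is propagated by the Jacobians,
    [w_(n+1) = w_n J_n]; after one period, [w_0] is fixed by the monodromy matrix,
    hence it vanishes and so does [w]. *)
Lemma cyclic_op_inj : ~~ eigenvalue (monodromy F G P u) 1 ->
  lker (cyclic_op F G P u) == 0%VS.
Proof.
rewrite /monodromy => noeig; apply/lker0P.
suff ker0 w : cyclic_op F G P u w = 0 -> w = 0.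
  move=> v w vw; apply/eqP; rewrite -subr_eq0; apply/eqP/ker0.
  by rewrite linearB /= vw subrr.
move=> w0; case: N F G u noeig w w0 => [|N'] F' G' u' noeig w w0.
  by apply/ffunP => -[].
set A := fun n => 'J (hprop F' G' P n) (u' n) in noeig.
have step n : w (ordS n) = w n *m A n.
  by apply/eqP; rewrite -subr_eq0 -cyclic_opE w0 ffunE.
have wE n : (n <= N')%N ->
    w (inord n) = w ord0 *m \big[mulmx/1%:M]_(0 <= i < n) A (inord i).
  elim: n => [_|n IH nN].
    by rewrite big_geq // mulmx1; congr (w _); apply/val_inj; rewrite /= inordK.
  rewrite big_nat_recr //= mulmxA -IH ?(ltnW nN) // -step; congr (w _).
  by apply/val_inj; rewrite /= !inordK ?modn_small // ltnS ltnW.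
have wper : w ord0 *m \big[mulmx/1%:M]_(n < N'.+1) A n = w ord0.
  have -> : \big[mulmx/1%:M]_(n < N'.+1) A n
      = \big[mulmx/1%:M]_(0 <= i < N'.+1) A (inord i).
    by rewrite big_mkord; apply: eq_bigr => i _; rewrite inord_val.
  rewrite big_nat_recr //= mulmxA -wE // -step; congr (w _).
  by apply/val_inj; rewrite /= inordK // modnn.
have w00 : w ord0 = 0.
  apply/eqP; apply: contraNT noeig => w00; apply/eigenvalueP.
  by exists (w ord0); rewrite ?scale1r.
apply/ffunP => n; rewrite ffunE -(inord_val n) wE ?w00 ?mul0mx //.
by rewrite -ltnS.
Qed.

Lemma hnorm_le_gammahat (w : history R N d) :
  ~~ eigenvalue (monodromy F G P u) 1 ->
  hnorm w <= gammahat F G P u * hnorm (cyclic_op F G P u w).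
Proof.
move=> noeig; rewrite -[leLHS](congr1 (@hnorm R N d)
  (lker0_lfunK (cyclic_op_inj noeig) w)).
exact: le_opnorm.
Qed.

End CyclicInverse.

(** * Error propagation *)

(** The one-step estimate for any matrix [P], with the norms of the error and of
    the iterate after [P] or [1 - P] replaced by upper bounds [p], [q], [r]. Since
    [F_n - H_n] is [x |-> D_n x - D_n (x P)], subtracting the update from the
    periodicity of [u] shows that the cyclic operator maps the new error to a
    Taylor remainder of [H_n] plus the increment of [F_n - H_n] from [V_n] to
    [u_n]. *)
Lemma pppc_error_le (R : realType) (N d : nat)
    (F G : 'I_N -> 'rV[R]_d -> 'rV[R]_d) (P : 'M[R]_d)
    (u V V' : history R N d) (B : set 'rV[R]_d) (mu nu kappa rad p q r : R) :
  let H := hprop F G P in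
  let e : history R N d := u - V in
  let Gam := gammahat F G P u in
  fine_periodic F u -> pppc_update F G P V V' -> convex_set B ->
  (forall n (s : R), 0 <= s <= 1 ->
     B (V n + s *: e n) /\ B ((V n + s *: e n) *m P)) ->
  (forall n, B (u n) /\ B (V' n)) ->
  (forall n, C1_near B (H n)) ->
  ~~ eigenvalue (monodromy F G P u) 1 ->
  (forall n, C1_near B (discr F G n)) ->
  0 <= mu -> 0 <= nu -> 0 <= kappa ->
  (forall n x, B x -> specnorm ('J (discr F G n) x) <= mu) ->
  (forall n x y, B x -> B y ->
     specnorm ('J (discr F G n) x - 'J (discr F G n) y) <= nu * enorm (x - y)) ->
  (forall n x y, B x -> B y ->
     specnorm ('J (H n) x - 'J (H n) y) <= kappa * enorm (x - y)) ->
  hnorm (u - V') <= rad -> 2^-1 * Gam * kappa * rad < 1 ->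
  0 <= p -> 0 <= q -> 0 <= r ->
  (forall n, enorm (e n *m P) <= p) ->
  (forall n, enorm (e n *m (1%:M - P)) <= q) ->
  (forall n, enorm (V n *m (1%:M - P)) <= r) ->
  hnorm (u - V') <= Gam / (1 - 2^-1 * Gam * kappa * rad)
                    * (mu * q + nu * r * p + nu / 2 * q * p).
Proof.
move=> H e Gam uF upd Bconv Bseg BuV' HC1 noeig DC1 mu0 nu0 kappa0 Dmu Dnu Hkappa
  rad_ge small p0 q0 r0 ep eq Vr.
set e' := u - V'; set beta := mu * q + _ + _.
have beta0 : 0 <= beta by rewrite !addr_ge0 ?mulr_ge0.
have Gam0 : 0 <= Gam by exact: opnorm_ge0.
have residual n : enorm (cyclic_op F G P u e' (ordS n))
    <= kappa / 2 * hnorm e' ^+ 2 + beta.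
  pose D := discr F G n.
  have uE : u n = V n + e n by rewrite /e !ffunE addrC subrK.
  have -> : cyclic_op F G P u e' (ordS n)
    = (H n (u n) - H n (V' n) - (u n - V' n) *m 'J (H n) (u n))
      + (D (V n + e n) - D ((V n + e n) *m P) - (D (V n) - D (V n *m P))).
    rewrite cyclic_opE -uE /e' !ffunE uF upd /D /H /hprop /discr.
    by apply/rowP => i; set j := _ *m 'J _ _; rewrite !mxE; ring.
  apply: le_trans (ler_enormD _ _) _; apply: lerD.
    have [Bu BV'] := BuV' n.
    apply: le_trans (taylor_remainder_le (HC1 n) Bconv BV' Bu (Hkappa n)) _.
    rewrite ler_wpM2l ?divr_ge0 // ler_pXn2r ?nnegrE ?enorm_ge0 ?hnorm_ge0 //.
    by have := le_enorm_hnorm e' n; rewrite !ffunE.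
  apply: le_trans (compl_increment_le (DC1 n) nu0 (Bseg n) (Dmu n) (Dnu n)) _.
  rewrite /beta -addrA; apply: lerD; first by rewrite ler_wpM2l.
  rewrite -!mulrA -mulrDr ler_wpM2l //.
  have -> : r * p + 2^-1 * (q * p) = (r + q / 2) * p by ring.
  by apply: ler_pM; rewrite ?addr_ge0 ?divr_ge0 ?enorm_ge0 ?lerD ?ler_wpM2r.
have E'0 := hnorm_ge0 e'.
have E'_le : hnorm e' <= Gam * (kappa / 2 * hnorm e' ^+ 2 + beta).
  apply: le_trans (hnorm_le_gammahat _ noeig) _; rewrite ler_wpM2l //.
  apply: hnorm_le => [|m]; first by rewrite addr_ge0 ?mulr_ge0 ?divr_ge0 ?exprn_ge0.
  by rewrite -(ord_predK m).
have den0 : 0 < 1 - 2^-1 * Gam * kappa * rad by rewrite subr_gt0.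
rewrite mulrAC ler_pdivlMr // mulrBr mulr1 lerBlDr.
(* one factor of the quadratic term is bounded by rad, the other is absorbed *)
apply: le_trans E'_le _; rewrite mulrDr addrC lerD2l.
have -> : hnorm e' * (2^-1 * Gam * kappa * rad)
  = Gam * (kappa / 2 * (hnorm e' * rad)) by ring.
by rewrite !ler_wpM2l ?divr_ge0 // expr2 ler_wpM2l.
Qed.

Theorem theorem4p4 (R : realType) (d N : nat) (T : R)
    (Omega : set 'rV[R]_d) (f : 'rV[R]_d -> R -> 'rV[R]_d)
    (F G : 'I_N -> 'rV[R]_d -> 'rV[R]_d) (ustar : history R N d)
    (U : nat -> history R N d) (rule : mode_rule N) (J : nat -> {set 'I_N})
    (k : nat) (B : set 'rV[R]_d) (mu nu kappa rad : R) :
  let e (j : nat) : history R N d := ustar - U j in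
  let E (j : nat) : R := hnorm (e j) in
  let P (m : nat) : 'M[R]_d := fourier_proj F G U (J m) m in
  let H (n : 'I_N) : 'rV[R]_d -> 'rV[R]_d := hprop F G (P k) n in
  let Gam : R := gammahat F G (P k) ustar in
  0 < T -> (0 < N)%N ->
  open Omega -> periodic_rhs T Omega f ->
  (forall n, Omega (ustar n)) ->
  (forall j n, (j <= k.+1)%N -> Omega (U j n)) ->
  fine_periodic F ustar ->
  (forall m, (m <= k)%N -> mode_selection rule U m (J m)) ->
  (forall m, (m <= k)%N -> pppc_update F G (P m) (U m) (U m.+1)) ->
  convex_set B ->
  (forall n s, 0 <= s <= 1 ->
     B (U k n + s *: e k n) /\ B ((U k n + s *: e k n) *m P k)) ->
  (forall n, B (ustar n) /\ B (U k.+1 n)) ->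
  (forall n, C1_near B (H n)) ->
  ~~ eigenvalue (monodromy F G (P k) ustar) 1 ->
  (forall n, C1_near B (discr F G n)) ->
  0 <= mu -> 0 <= nu -> 0 <= kappa ->
  (forall n x, B x -> specnorm ('J (discr F G n) x) <= mu) ->
  (forall n x y, B x -> B y ->
     specnorm ('J (discr F G n) x - 'J (discr F G n) y) <= nu * enorm (x - y)) ->
  (forall n x y, B x -> B y ->
     specnorm ('J (H n) x - 'J (H n) y) <= kappa * enorm (x - y)) ->
  0 < rad -> E k.+1 <= rad -> 2^-1 * Gam * kappa * rad < 1 ->
  (E k = 0 -> E k.+1 = 0) /\
  (0 < E k ->
     E k.+1 <= rhoF Gam mu nu kappa rad (J k) (P k) (U k) (e k) * E k).
Proof.
move=> e E P H Gam _ N0 _ _ _ _ uF _ upd Bconv Bseg BuU HC1 noeig DC1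
  mu0 nu0 kappa0 Dmu Dnu Hkappa _ rad_ge small.
have main p q := @pppc_error_le R N d F G (P k) ustar (U k) (U k.+1) B mu nu
  kappa rad p q (Uperp (P k) (U k)) uF (upd k (leqnn k)) Bconv Bseg BuU HC1 noeig
  DC1 mu0 nu0 kappa0 Dmu Dnu Hkappa rad_ge small.
have r0 : 0 <= Uperp (P k) (U k) by exact: bigmax_ge_id.
have Ur n : enorm (U k n *m (1%:M - P k)) <= Uperp (P k) (U k).
  exact: (le_bigmax _ (fun n => enorm (U k n *m (1%:M - P k)))).
(* a zero error allows p = q = 0, where the ratios would divide by zero *)
split=> [/hnorm0_eq0 ek0|Ek0].
  apply/eqP; rewrite -normr_le0 ger0_norm ?hnorm_ge0 //.
  rewrite -[leRHS](mulr0 (Gam / (1 - 2^-1 * Gam * kappa * rad))).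
  have -> : 0 = mu * 0 + nu * Uperp (P k) (U k) * 0 + nu / 2 * 0 * 0 :> R by ring.
  by apply: main => // n; rewrite -/(e k) ek0 ffunE mul0mx enorm0.
set tl := (Num.sqrt N%:R)^-1 * (tail_sum (J k) (e k) + leak (J k) (P k) (e k)).
set p := \big[Num.max/0]_(n < N) enorm (e k n *m P k).
have sN0 : 0 < Num.sqrt N%:R :> R by rewrite sqrtr_gt0 ltr0n.
have -> : rhoF Gam mu nu kappa rad (J k) (P k) (U k) (e k) * E k
  = Gam / (1 - 2^-1 * Gam * kappa * rad)
    * (mu * tl + nu * Uperp (P k) (U k) * p + nu / 2 * tl * p).
  rewrite /rhoF -mulrA; congr (_ * _); rewrite /thetaQ /thetaP -/p /tl -/(E k).
  by field; rewrite !gt_eqF.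
apply: main => //.
- exact: bigmax_ge_id.
- apply: mulr_ge0; first by rewrite invr_ge0 ltW.
  by apply: addr_ge0; apply: sumr_ge0 => l _; exact: cenorm_ge0.
- by move=> n; exact: (le_bigmax _ (fun n => enorm (e k n *m P k))).
- move=> n; apply: enorm_compl_le_tail_leak.
  exact: orthoproj_compl_contraction.
Qed.
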